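(* Let $p\equiv 4\pmod 5$ be a prime, and let $N$ be a positive integer which is coprime to $p$ such that $pN\equiv 3\pmod 8$. Then \[\mathrm{pod}\Big(\frac{5p^{3}N+1}{8}\Big)\equiv 0\pmod 5.\]
   Context: For an integer $n\ge 0$, $\mathrm{pod}(n)$ denotes the number of partitions of $n$ in which the odd parts are distinct (even parts may repeat); equivalently $\sum_{n\ge 0}\mathrm{pod}(n)q^n=\prod_{i\ge 1}\frac{1+q^{2i-1}}{1-q^{2i}}$. *)

(* Defs.v *)
From mathcomp Require Import all_boot.

Set Implicit Arguments.
Unset Strict Implicit.
Unset Printing Implicit Defensive.

(* Parts are listed in nonincreasing order, so that a partition is represented
   by exactly one sequence. *)
Definition is_partition (n : nat) (s : seq nat) : bool :=
  [&& sorted geq s, all (leq 1) s & sumn s == n].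

Definition odd_parts_distinct (s : seq nat) : bool :=
  uniq [seq x <- s | odd x].

(* The bounds in the type of [s] lose no partition of [n], by
   [size_is_partition] and [parts_is_partition] below. *)
Definition pod (n : nat) : nat :=
  #|[set s : {bseq n of 'I_n.+1} |
      is_partition n (map val s) && odd_parts_distinct (map val s)]|.

Lemma size_is_partition (n : nat) (s : seq nat) :
  is_partition n s -> size s <= n.
Proof.
case/and3P=> _ + /eqP <-; elim: s => //= x s IHs /andP[x_gt0 /IHs le_s].
by rewrite -add1n leq_add.
Qed.

Lemma parts_is_partition (n : nat) (s : seq nat) :
  is_partition n s -> all (fun x => x < n.+1) s.
Proof.
case/and3P=> _ _ /eqP <-; apply/allP=> x; rewrite ltnS.
elim: s => //= y s IHs; rewrite inE => /predU1P[->|/IHs le_x].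
  exact: leq_addr.
exact: leq_trans le_x (leq_addl _ _).
Qed.

(* Main.v *)
From HB Require Import structures.
Require Import Defs.
From mathcomp Require Import all_boot all_order all_algebra.
From mathcomp Require Import zify ring lra.

(* The generating function of [pod] at [-q] is the inverse of the theta series
   [psi(q) = sum_s q^(s(s+1)/2)] (Gauss, here through a finite identity of
   Shanks).  Since [psi(q)^5 = psi(q^5)] modulo 5, it is also
   [psi(q)^4 / psi(q^5)]; the terms of [psi(q)^4] with exponents in [5n+2] form
   a copy of [psi(q)^4] modulo 5, because [r_2(5m) + r_2(m/5) = 2 r_2(m)].
   Hence [pod(5n+2)] is, up to sign, the coefficient of [q^n] in [psi(q)^3]
   modulo 5, that is [r_3(8n+3) / 8].
   For [8n+3 = p^2 m] with [m = pN], each of the [p+1] isotropic lines of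
   [F_p^3] is annihilated on the left by a quaternion [a] of norm [p], and the
   maps [y |-> conj a * y * a] cover the vectors of norm [p^2 m] exactly once by
   those of norm [m].  Therefore [r_3(p^2 m) = (p+1) r_3(m)], and 5 divides
   [p+1]. *)

Set Implicit Arguments.
Unset Strict Implicit.
Unset Printing Implicit Defensive.
Import Order.TTheory GRing.Theory Num.Theory.

(** * The generating function of [pod] *)

Section PodRecurrence.

Definition pod_seq (m n : nat) (s : seq nat) : bool :=
  [&& is_partition n s, odd_parts_distinct s & all (geq m) s].

Definition pod_seqs (m n : nat) : seq (seq nat) :=
  [seq s <- [seq map val (bseqval b) | b <- enum {: {bseq n of 'I_n.+1}}] |
     pod_seq m n s].

Definition pod_le (m n : nat) : nat := size (pod_seqs m n).

Lemma pod_seqs_uniq m n : uniq (pod_seqs m n).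
Proof.
apply: filter_uniq; rewrite map_inj_uniq ?enum_uniq // => b c eq_bc.
by apply/val_inj/(inj_map val_inj).
Qed.

Lemma mem_pod_seqs m n s : (s \in pod_seqs m n) = pod_seq m n s.
Proof.
rewrite mem_filter andbC; case: (boolP (pod_seq m n s)) => [/and3P[sP _ _]|];
  rewrite ?andbF // andbT.
have le_size := size_is_partition sP; have /allP le_n := parts_is_partition sP.
have def_s : map val (map inord s : seq 'I_n.+1) = s.
  by rewrite -map_comp map_id_in // => x /le_n x_lt /=; rewrite inordK.
have sizeP : size (map inord s : seq 'I_n.+1) <= n by rewrite size_map.
by apply/mapP; exists (Bseq sizeP); rewrite ?mem_enum.
Qed.

Lemma pod_pod_le n : pod n = pod_le n n.
Proof.
rewrite /pod /pod_le /pod_seqs cardsE filter_map size_map cardE.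
rewrite /enum_mem filter_predT !size_filter; apply: eq_count => b.
set s := map val b; rewrite /= -/s /pod_seq.
rewrite -[LHS]/(is_partition n s && odd_parts_distinct s).
case: (boolP (is_partition _ _)) => //= sP.
suff -> : all (geq n) s by rewrite andbT.
by apply/allP => x /(allP (parts_is_partition sP)).
Qed.

Lemma is_partition_cons n x s :
  is_partition n (x :: s) =
    [&& 0 < x, x <= n, all (geq x) s & is_partition (n - x) s].
Proof.
rewrite /is_partition /= path_sortedE; last by move=> a b c /=; lia.
case: (all (geq x) s); rewrite ?andbF //=.
by case: (sorted geq s); case: (all (leq 1) s); rewrite ?andbF //=; lia.
Qed.

Lemma is_partition_nil n : is_partition n [::] = (n == 0).
Proof. by rewrite /is_partition /= eq_sym. Qed.

Lemma pod_le0 n : pod_le 0 n = (n == 0).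
Proof.
have: perm_eq (pod_seqs 0 n) (if n == 0 then [:: [::]] else [::]).
  apply: uniq_perm; rewrite ?pod_seqs_uniq //; first by case: (n == 0).
  move=> [|x s]; rewrite mem_pod_seqs /pod_seq.
    by rewrite is_partition_nil; case: (n == 0).
  by rewrite is_partition_cons; case: (n == 0); case: x => [|x]; rewrite /= ?andbF.
by move/perm_size; rewrite /pod_le => ->; case: (n == 0).
Qed.

(** Split according to whether the largest part is [m.+1]. After one copy of it is removed, an even
    [m.+1] may occur again and an odd one may not, whence the bound on the remaining parts. *)
Lemma pod_leS m n :
  pod_le m.+1 n = pod_le m n +
    (m < n) * pod_le (if odd m then m.+1 else m) (n - m.+1).
Proof.
set m' := if odd m then _ else _.
have: perm_eq (pod_seqs m.+1 n) (pod_seqs m n ++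
    if m < n then map (cons m.+1) (pod_seqs m' (n - m.+1)) else [::]).
  apply: uniq_perm; rewrite ?pod_seqs_uniq //.
    rewrite cat_uniq pod_seqs_uniq /=; case: ifP => //= _.
    rewrite map_inj_uniq ?pod_seqs_uniq ?andbT; last by move=> ? ? [].
    apply/hasPn => s /mapP[t _ ->]; rewrite mem_pod_seqs /pod_seq /=; lia.
  move=> s; rewrite mem_cat !mem_pod_seqs.
  have -> : (s \in (if m < n then map (cons m.+1) (pod_seqs m' (n - m.+1))
               else [::])) =
            [&& m < n, ohead s == Some m.+1 & pod_seq m' (n - m.+1) (behead s)].
    case: (m < n) => //=; apply/mapP/andP => [[t tP ->]|[]].
      by rewrite /= -mem_pod_seqs.
    case: s => //= x s /eqP[->]; rewrite -mem_pod_seqs => sP; by exists s.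
  rewrite /pod_seq; case: s => [|x s] /=; first by rewrite andbF orbF.
  rewrite is_partition_cons -[Some x == _]/(x == m.+1).
  case: (ltngtP x m.+1) => [x_lt|x_gt|->]; rewrite ?andbF ?orbF ?andbT /=.
  - have -> : x <= m by lia.
    case: (boolP (all (geq x) s)) => sx; rewrite ?andbF //=.
    have le_x k : x <= k -> all (geq k) s.
      by move=> le_xk; apply: sub_all sx => y /= /leq_trans->.
    by rewrite !le_x //; lia.
  - have -> : (x <= m) = false by lia.
    by rewrite /= ?andbF.
  - rewrite ltnn /= !andbF /=.
    case: (ltnP m n) => //= _; rewrite /odd_parts_distinct /=.
    case: (boolP (is_partition _ s)); rewrite ?andbF //= => sP.
    case: (boolP (all (geq m.+1) s)) => sm; rewrite ?andbF ?andbT /=; last first.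
      apply/esym/negbTE; apply: contra sm => /andP[_].
      by apply: sub_all => y /= /leq_trans-> //; rewrite /m'; case: (odd m).
    rewrite /m'; case m_odd: (odd m) => /=; first by rewrite sm andbT.
    (* Here [m.+1] is odd. As the parts of [s] are at most [m.+1], its absence from [s] means that
       they are all at most [m]. *)
    rewrite mem_filter /= m_odd /= andbC; congr (_ && _).
    apply/idP/allP => [sm1 y ys|sm1]; last by apply/negP => /sm1 /=; rewrite ltnn.
    have := allP sm y ys; rewrite /= leq_eqVlt => /predU1P[y_m|//].
    by rewrite -y_m ys in sm1.
move/perm_size; rewrite /pod_le size_cat => ->.
by case: (m < n); rewrite ?size_map ?mul1n.
Qed.
End PodRecurrence.

(** * Shanks's finite form of Gauss's identity for psi *)

Section Shanks.
Local Open Scope ring_scope.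
Variables (R : comNzRingType) (q : R).

Definition even_prod m n : R := \prod_(m <= i < n) (1 - q ^+ (2 * i)).
Definition odd_prod n : R := \prod_(0 <= i < n) (1 - q ^+ (2 * i + 1)).

Lemma odd_prodS n : odd_prod n.+1 = odd_prod n * (1 - q ^+ (2 * n + 1)).
Proof. by rewrite /odd_prod big_nat_recr. Qed.

Lemma even_prodS m n : (m <= n)%N ->
  even_prod m n.+1 = even_prod m n * (1 - q ^+ (2 * n)).
Proof. by move=> le_mn; rewrite /even_prod big_nat_recr. Qed.

(** With P_n the quotient of [even_prod 1 n.+1] by [odd_prod n], this is the identity sum_(s < n)
    (P_n / P_s) q^(s(2n+1)) = sum_(s < 2n) q^C(s+1, 2) with denominators cleared. *)
Lemma shanks_identity n :
  \sum_(0 <= s < n) even_prod s.+1 n.+1 * odd_prod s * q ^+ (s * (2 * n + 1)) =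
  odd_prod n * \sum_(0 <= s < 2 * n) q ^+ 'C(s.+1, 2).
Proof.
elim: n => [|n IHn]; first by rewrite muln0 !big_geq ?mulr0.
set b := fun s => even_prod s n.+1 * odd_prod s * q ^+ (s * (2 * n + 1)).
have even_id k : even_prod k k = 1 by rewrite /even_prod big_geq.
(* Passing from [n] to [n.+1] multiplies each term by the new factor of [odd_prod], up to a
   difference that telescopes. *)
have step s : (0 <= s < n)%N ->
    even_prod s.+1 n.+2 * odd_prod s * q ^+ (s * (2 * n.+1 + 1)) =
    (1 - q ^+ (2 * n + 1)) *
      (even_prod s.+1 n.+1 * odd_prod s * q ^+ (s * (2 * n + 1))) +
    (b s.+1 - b s).
  move=> /= s_lt; rewrite /b even_prodS 1?odd_prodS; last by lia.
  have -> : even_prod s n.+1 = (1 - q ^+ (2 * s)) * even_prod s.+1 n.+1.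
    by rewrite /even_prod big_nat_recl ?big_add1 //; lia.
  have -> : (2 * n.+1 = (2 * n + 1) + 1)%N by lia.
  have -> : (s * (2 * n + 1 + 1 + 1) = s * (2 * n + 1) + 2 * s)%N by lia.
  have -> : (s.+1 * (2 * n + 1) = s * (2 * n + 1) + (2 * n + 1))%N by lia.
  rewrite !exprD expr1; ring.
rewrite big_nat_recr //= (eq_big_nat _ _ step) big_split /= -big_distrr /= IHn.
rewrite telescope_sumr //.
have -> : (2 * n.+1 = (2 * n).+2)%N by lia.
rewrite !big_nat_recr //=.
(* The factor [1 - q ^+ 0] kills [b 0], so the telescoped sum reduces to [b n]. *)
have even0 : even_prod 0 n.+1 = 0.
  by rewrite /even_prod big_ltn // muln0 expr0 subrr mul0r.
rewrite /b !odd_prodS even0 (@even_prodS n.+1 n.+1) // (@even_prodS n n) //.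
rewrite !even_id !mul0r subr0.
have -> : 'C((2 * n).+1, 2) = (n * (2 * n + 1))%N.
  by rewrite bin2 /= (_ : (_ * _ = (n * (2 * n + 1)).*2)%N) ?doubleK; lia.
have -> : 'C((2 * n).+2, 2) = (n * (2 * n + 1) + (2 * n + 1))%N.
  rewrite bin2 (_ : ((2 * n).+2 * (2 * n).+2.-1 = (n.+1 * (2 * n + 1)).*2)%N).
    by rewrite doubleK; lia.
  by rewrite /=; lia.
have -> : (n * ((2 * n).+2 + 1) = n * (2 * n + 1) + 2 * n)%N by lia.
have -> : (2 * n.+1 = 2 * n + 1 + 1)%N by lia.
rewrite !exprD expr1; ring.
Qed.
End Shanks.

(** * Congruence of polynomials modulo a power of X *)

Section TruncatedEquality.
Local Open Scope ring_scope.
Variable (R : comNzRingType).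
Implicit Types p q r : {poly R}.

Definition eqX K p q := forall i, (i < K)%N -> p`_i = q`_i.

Lemma eqX_trans K q p r : eqX K p q -> eqX K q r -> eqX K p r.
Proof. by move=> pq qr i i_lt; rewrite pq ?qr. Qed.

Lemma eqX_leq J K p q : (J <= K)%N -> eqX K p q -> eqX J p q.
Proof. by move=> le_JK pq i i_lt; rewrite pq // (leq_trans i_lt). Qed.

Lemma eqXM K p p' q q' : eqX K p p' -> eqX K q q' -> eqX K (p * q) (p' * q').
Proof.
move=> pp qq i i_lt; rewrite !coefM; apply: eq_bigr => j _.
by rewrite pp ?qq //; have := ltn_ord j; lia.
Qed.

Lemma eqXMl K r p q : eqX K p q -> eqX K (r * p) (r * q).
Proof. exact: eqXM. Qed.

Lemma eqX_exp K p q n : eqX K p q -> eqX K (p ^+ n) (q ^+ n).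
Proof. by move=> pq; elim: n => // n IHn; rewrite !exprS; apply: eqXM. Qed.

(** Coefficient [i] of [r * p] is that of [p] plus terms in earlier coefficients of [p], which agree
    with those of [q] by strong induction. *)
Lemma eqX_cancel K r p q : r`_0 = 1 -> eqX K (r * p) (r * q) -> eqX K p q.
Proof.
move=> r0 rpq i; elim/ltn_ind: i => i IHi i_lt.
move/(_ i i_lt): rpq; rewrite !coefM !big_ord_recl /= r0 subn0 !mul1r.
rewrite (eq_bigr (fun j : 'I_i => r`_(bump 0 j) * q`_(i - bump 0 j))).
  by move/addIr.
by move=> j _; rewrite IHi //; rewrite /bump /=; have := ltn_ord j; lia.
Qed.

End TruncatedEquality.

(** * The product formula for pod at -q, and its inverse psi *)

Section PodSeries.
Local Open Scope ring_scope.
Variable (R : comNzRingType).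

(** The sign substitutes -X for X, which turns the factors 1 + q^(2i-1) into those of [odd_prod]. *)
Definition pod_le_poly m K : {poly R} :=
  \poly_(i < K) ((-1) ^+ i * (pod_le m i)%:R).
Definition pod_poly K : {poly R} := \poly_(i < K) ((-1) ^+ i * (pod i)%:R).
Definition psi n : {poly R} := \sum_(0 <= s < n) 'X^('C(s.+1, 2)).

(** The odd part [m.+1] occurs at most once and contributes the factor 1 + (-X)^(m+1). *)
Lemma pod_le_poly_odd m K : ~~ odd m ->
  eqX K (pod_le_poly m.+1 K) ((1 - 'X^(m.+1)) * pod_le_poly m K).
Proof.
move=> m_even i i_lt; rewrite mulrBl mul1r coefB coefXnM !coef_poly i_lt.
rewrite pod_leS (negPf m_even) natrD mulrDr ltnS.
case: leqP => [le_im | lt_mi]; first by rewrite mul0n mulr0 addr0 subr0.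
rewrite (leq_ltn_trans (leq_subr _ _) i_lt) mul1n.
rewrite -[in (-1) ^+ i * (pod_le m (i - _))%:R](subnK lt_mi) exprD.
by rewrite -[(-1) ^+ m.+1]signr_odd /= m_even expr1 mulrN1 mulNr addnK.
Qed.

(** The even part [m.+1] may repeat and contributes a geometric series, cleared here by its
    denominator. *)
Lemma pod_le_poly_even m K : odd m ->
  eqX K ((1 - 'X^(m.+1)) * pod_le_poly m.+1 K) (pod_le_poly m K).
Proof.
move=> m_odd i i_lt; rewrite mulrBl mul1r coefB coefXnM !coef_poly i_lt.
rewrite pod_leS m_odd natrD mulrDr ltnS.
case: leqP => [le_im | lt_mi]; first by rewrite mul0n mulr0 addr0 subr0.
rewrite (leq_ltn_trans (leq_subr _ _) i_lt) mul1n.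
rewrite -[in (-1) ^+ i * (pod_le m.+1 (i - _))%:R](subnK lt_mi) exprD.
by rewrite -[(-1) ^+ m.+1]signr_odd /= m_odd expr0 mulr1 addnK addrK.
Qed.

Lemma pod_le_poly_prod n K :
  eqX K (even_prod 'X 1 n.+1 * pod_le_poly (2 * n) K) (odd_prod 'X n).
Proof.
elim: n => [|n IHn].
  rewrite /even_prod /odd_prod !big_geq // mul1r => i i_lt.
  by rewrite coef_poly i_lt pod_le0 coef1; case: i i_lt => [|i] _;
    rewrite ?mulr1 ?mulr0.
rewrite odd_prodS even_prodS // mulnS !add2n -mulrA (mulrC (odd_prod _ _)).
apply: eqX_trans _ (eqXMl _ IHn).
rewrite [X in eqX _ _ X]mulrCA; apply: eqXMl.
apply: eqX_trans (@pod_le_poly_even (2 * n).+1 K _) _.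
  by rewrite /= mul2n odd_double.
by rewrite addn1; apply: pod_le_poly_odd; rewrite mul2n odd_double.
Qed.

Lemma pod_le_pod m n : (n <= m)%N -> pod_le m n = pod n.
Proof.
rewrite pod_pod_le => /subnKC <-; elim: (m - n)%N => [|k IHk]; first by rewrite addn0.
by rewrite addnS pod_leS IHk ltnNge leq_addr mul0n addn0.
Qed.

(** In Shanks's identity the terms with [s > 0] are multiples of X^(2n+1), so only the term [s = 0]
    remains. *)
Lemma psi_prod n : (0 < n)%N ->
  eqX (2 * n + 1) (odd_prod 'X n * psi (2 * n)) (even_prod 'X 1 n.+1).
Proof.
case: n => // n _ i i_lt; rewrite /psi -shanks_identity big_nat_recl //.
rewrite coefD mul0n expr0 mulr1 /odd_prod (big_geq (leqnn 0)).
rewrite mulr1 coef_sum big1 ?addr0 //.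
move=> s _; rewrite coefMXn ifT //; nia.
Qed.

(** Multiplication by [odd_prod 'X n] turns psi into the even product, and the even product times
    [pod_poly] is [odd_prod 'X n] again, which cancels. *)
Lemma pod_poly_psi n : (0 < n)%N ->
  eqX (2 * n + 1) (pod_poly (2 * n + 1) * psi (2 * n)) 1.
Proof.
move=> n_gt0; set K := (2 * n + 1)%N.
have pd : eqX K (pod_poly K) (pod_le_poly (2 * n) K).
  by move=> i i_lt; rewrite !coef_poly i_lt pod_le_pod //; lia.
have odd0 : (odd_prod 'X n : {poly R})`_0 = 1.
  rewrite /odd_prod; elim: {+}n => [|k IHk]; first by rewrite big_geq ?coef1.
  by rewrite big_nat_recr //= coef0M IHk coefB coef1 coefXn addn1 subr0 mulr1.
apply: (eqX_cancel odd0); rewrite mulrCA mulr1.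
apply: eqX_trans (eqXM pd (psi_prod n_gt0)) _.
by rewrite mulrC; apply: pod_le_poly_prod.
Qed.

End PodSeries.

(** * Sums of squares and triangular numbers *)

Section SumsOfSquares.
Local Open Scope ring_scope.

Definition ibox (B : nat) : seq int := map Posz (iota 0 B.+1) ++ map Negz (iota 0 B).

Arguments ibox : simpl never.

Lemma ibox_uniq B : uniq (ibox B).
Proof.
rewrite cat_uniq !map_inj_uniq ?iota_uniq /= ?andbT; try by move=> x y [].
by apply/hasPn => x /mapP[y _ ->]; apply/mapP => -[].
Qed.

Lemma mem_ibox B x : (x \in ibox B) = (`|x| <= B)%N.
Proof.
rewrite mem_cat; apply/orP/idP.
  by case=> /mapP[y]; rewrite mem_iota => y_lt ->; lia.
case: x => x x_le; [left | right]; apply/mapP; exists x => //;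
  rewrite mem_iota; lia.
Qed.

Definition sq2 (u : int * int) : int := u.1 ^+ 2 + u.2 ^+ 2.
Definition sq3 (u : int * int * int) : int := sq2 u.1 + u.2 ^+ 2.

(** The box is large enough because |x| <= x^2 for integers; the lengths of [sol2 m] and [sol3 m]
    are r_2(m) and r_3(m). *)
Definition sol2 (m : nat) : seq (int * int) :=
  [seq u <- [seq (x, y) | x <- ibox m, y <- ibox m] | sq2 u == m].
Definition sol3 (m : nat) : seq (int * int * int) :=
  [seq u <- [seq (v, z) | v <- [seq (x, y) | x <- ibox m, y <- ibox m],
                          z <- ibox m] | sq3 u == m].

Lemma allpairs_pair_uniq (S T : eqType) (s : seq S) (t : seq T) :
  uniq s -> uniq t -> uniq [seq (x, y) | x <- s, y <- t].
Proof. by move=> s_uniq t_uniq; apply: allpairs_uniq => // -[? ?] [? ?]. Qed.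

Lemma sol2_uniq m : uniq (sol2 m).
Proof. by apply/filter_uniq/allpairs_pair_uniq; apply: ibox_uniq. Qed.

Lemma sol3_uniq m : uniq (sol3 m).
Proof. by do ![apply/filter_uniq | apply/allpairs_pair_uniq | apply/ibox_uniq]. Qed.

Lemma mem_allpairs_pair (S T : eqType) (s : seq S) (t : seq T) x y :
  ((x, y) \in [seq (a, b) | a <- s, b <- t]) = (x \in s) && (y \in t).
Proof.
apply/allpairsP/andP => [[[a b] /= [? ? [-> ->]]] // | [xs yt]].
by exists (x, y).
Qed.

Lemma mem_sol2 m u : (u \in sol2 m) = (sq2 u == m).
Proof.
rewrite mem_filter andbC; case: eqP; rewrite ?andbF ?andbT //.
case: u => x y; rewrite mem_allpairs_pair !mem_ibox /sq2 /= => sq_u.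
by apply/andP; split; nia.
Qed.

Lemma mem_sol3 m u : (u \in sol3 m) = (sq3 u == m).
Proof.
rewrite mem_filter andbC; case: eqP; rewrite ?andbF ?andbT //.
case: u => [[x y] z]; rewrite !mem_allpairs_pair !mem_ibox -andbA /sq3 /sq2 /= => sq_u.
by apply/and3P; split; nia.
Qed.

Lemma Euclid_dvdzM (p : nat) (x y : int) : prime p ->
  (p %| x * y)%Z = (p %| x)%Z || (p %| y)%Z.
Proof. by move=> p_pr; rewrite !dvdzE abszM Euclid_dvdM. Qed.

(* In the Gaussian integers a multiple of 5 in norm is divisible by [2 + i] or
   by [2 - i], and by both only if it is divisible by 5. *)
Lemma size_sol2_5 m :
  (size (sol2 (5 * m)) + (if (5 %| m)%N then size (sol2 (m %/ 5)) else 0) =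
   2 * size (sol2 m))%N.
Proof.
(* Reading [u] as the Gaussian integer u.1 + i u.2, [A] describes the multiples of 2 + i and [B]
   those of 2 - i. *)
pose A := [pred u : int * int | (5 %| u.1 - 2 * u.2)%Z].
pose B := [pred u : int * int | (5 %| u.1 + 2 * u.2)%Z].
(* Multiplication by a Gaussian integer of norm [c] is an injection [f] with image [P]; it matches
   the solutions for [k] with those for [5 * m] in [P]. *)
have count_mul (P : pred (int * int)) (k c : nat) (f : int * int -> int * int) :
    (0 < c)%N -> (c * k = 5 * m)%N -> injective f ->
    (forall v, sq2 (f v) = c%:Z * sq2 v) ->
    (forall v, P (f v)) -> (forall u, P u -> exists v, u = f v) ->
    count P (sol2 (5 * m)) = size (sol2 k).
  move=> c_gt0 ck f_inj f_sq fP Pf.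
  rewrite -size_filter -(size_map f (sol2 k)); apply: perm_size.
  have sq_fE v : (sq2 (f v) == (5 * m)%N) = (sq2 v == k).
    rewrite f_sq -ck PoszM; apply/eqP/eqP => [|->] //; apply: mulfI.
    by lia.
  apply: uniq_perm => [||u].
  - exact/filter_uniq/sol2_uniq.
  - by rewrite map_inj_uniq ?sol2_uniq.
  rewrite mem_filter mem_sol2; apply/andP/mapP => [[/Pf[v ->]]|[v]].
    by rewrite sq_fE => ?; exists v; rewrite ?mem_sol2.
  by rewrite mem_sol2 -sq_fE => sq_v ->.
(* Inclusion-exclusion: every solution satisfies [A] or [B], since (x - 2y)(x + 2y) = x^2 + y^2 -
   5y^2. *)
have -> : size (sol2 (5 * m)) = (count A (sol2 (5 * m)) + count B (sol2 (5 * m))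
   - count (predI A B) (sol2 (5 * m)))%N.
  rewrite -count_predUI addnK -size_filter; congr size; apply/esym/all_filterP.
  apply/allP => -[x y]; rewrite mem_sol2 /sq2 /= => /eqP sq_u.
  rewrite -(@Euclid_dvdzM 5) //.
  rewrite (_ : _ * _ = x ^+ 2 + y ^+ 2 - 5 * y ^+ 2); last by ring.
  by rewrite sq_u; lia.
have cA : count A (sol2 (5 * m)) = size (sol2 m).
  apply: (count_mul _ _ 5%N (fun u => (2 * u.1 - u.2, u.1 + 2 * u.2))) => //=.
  - by move=> [x y] [x' y'] /= [? ?]; congr (_, _); lia.
  - by rewrite /sq2 => -[x y] /=; ring.
  - by move=> [x y] /=; lia.
  move=> [x y] /= u_dvd.
  by exists (((2 * x + y) %/ 5)%Z, ((2 * y - x) %/ 5)%Z); congr (_, _) => /=; lia.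
have cB : count B (sol2 (5 * m)) = size (sol2 m).
  apply: (count_mul _ _ 5%N (fun u => (2 * u.1 + u.2, 2 * u.2 - u.1))) => //=.
  - by move=> [x y] [x' y'] /= [? ?]; congr (_, _); lia.
  - by rewrite /sq2 => -[x y] /=; ring.
  - by move=> [x y] /=; lia.
  move=> [x y] /= u_dvd.
  by exists (((2 * x - y) %/ 5)%Z, ((2 * y + x) %/ 5)%Z); congr (_, _) => /=; lia.
have ABdvd x y : predI A B (x, y) -> x = 5 * (x %/ 5)%Z /\ y = 5 * (y %/ 5)%Z.
  by move=> /= u_dvd; lia.
have cAB : count (predI A B) (sol2 (5 * m)) =
    if (5 %| m)%N then size (sol2 (m %/ 5)) else 0.
  case: ifPn => [m5|m5N].
    apply: (count_mul _ _ 25%N (fun u => (5 * u.1, 5 * u.2))) => //=.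
    - by lia.
    - by move=> [x y] [x' y'] /= [? ?]; congr (_, _); lia.
    - by rewrite /sq2 => -[x y] /=; ring.
    - by move=> [x y] /=; lia.
    move=> [x y] /ABdvd[def_x def_y].
    by exists ((x %/ 5)%Z, (y %/ 5)%Z); congr (_, _).
  apply/eqP; rewrite eqn0Ngt -has_count; apply/hasPn => -[x y].
  rewrite mem_sol2 /sq2 => /eqP sq_u; apply: contra m5N => /ABdvd[def_x def_y].
  move: sq_u; rewrite def_x def_y /= !exprMn -mulrDr.
  by move: (_ ^+ 2 + _) => k; lia.
have : (count (predI A B) (sol2 (5 * m)) <= count A (sol2 (5 * m)))%N.
  by apply: sub_count => u /andP[].
rewrite cA cB cAB => le_m.
by rewrite addnn subnK ?mul2n // -addnn (leq_trans le_m) ?leq_addr.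
Qed.
End SumsOfSquares.

(** * Powers of psi and sums of odd squares *)

Section TriangularNumbers.
Local Open Scope ring_scope.
Variable R : comNzRingType.

Definition odd_box n : seq int :=
  [seq (2 * s + 1)%N%:Z | s <- iota 0 n] ++ [seq - (2 * s + 1)%N%:Z | s <- iota 0 n].
Arguments odd_box : simpl never.

(** For odd [x] this is the triangular number (x^2 - 1) / 8. *)
Definition tri_index (x : int) : nat := (`|x| ^ 2 %/ 8)%N.

Lemma tri_indexE s : tri_index (2 * s + 1)%N = 'C(s.+1, 2).
Proof.
rewrite /tri_index absz_nat bin2 /=.
have : ((s.+1 * s)./2.*2 = s.+1 * s)%N by rewrite even_halfK // oddM /= andNb.
by move: (_./2) => t; nia.
Qed.

Lemma odd_box_uniq n : uniq (odd_box n).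
Proof.
rewrite cat_uniq !map_inj_uniq ?iota_uniq /= ?andbT => [|x y|x y]; try lia.
by apply/hasPn => x /mapP[y _ ->]; apply/mapP => -[z _]; lia.
Qed.

Lemma mem_odd_box n x : (x \in odd_box n) = odd `|x| && (`|x| < 2 * n)%N.
Proof.
rewrite mem_cat; apply/orP/andP.
  by case=> /mapP[s]; rewrite mem_iota => s_lt ->; split; lia.
move=> [x_odd x_lt].
by case: (lerP 0 x) => x0; [left | right]; apply/mapP; exists (`|x|./2)%N;
  rewrite ?mem_iota; lia.
Qed.

Lemma psi_odd_box n :
  2 * psi R n = \sum_(x <- odd_box n) 'X^(tri_index x).
Proof.
rewrite /psi /index_iota subn0 big_cat !big_map /= mulr2n mulrDl !mul1r.
by congr (_ + _); apply: eq_bigr => s _; rewrite /tri_index ?abszN;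
  rewrite -/(tri_index _) tri_indexE.
Qed.

Lemma coef_sumXn (I : Type) (r : seq I) (e : I -> nat) i :
  (\sum_(x <- r) 'X^(e x) : {poly R})`_i = (count (fun x => e x == i) r)%:R.
Proof.
rewrite coef_sum; elim: r => [|x r IHr]; first by rewrite big_nil.
by rewrite big_cons IHr coefXn eq_sym /= natrD.
Qed.

(** Squares are 0, 1 or 4 modulo 8, so every term is odd in a sum of two squares equal to 8i+2 or of
    three equal to 8i+3. *)
Lemma sqrn_mod8 a : (a ^ 2 = 8 * (a ^ 2 %/ 8) +
  (if odd a then 1 else if odd a./2 then 4 else 0))%N.
Proof.
have [k [r [r_lt ->]]] : exists k r, (r < 4)%N /\ a = (4 * k + r)%N.
  by exists (a %/ 4)%N, (a %% 4)%N; rewrite ltn_mod mulnC -divn_eq.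
case: r r_lt => [|[|[|[|//]]]] _; [ | | | ].
- have [-> ->] : odd (4 * k + 0) = false /\ odd (4 * k + 0)./2 = false by lia.
  by lia.
- have -> : odd (4 * k + 1) by lia.
  by lia.
- have [-> ->] : odd (4 * k + 2) = false /\ odd (4 * k + 2)./2 by lia.
  by lia.
- have -> : odd (4 * k + 3) by lia.
  by lia.
Qed.

Lemma sqrz_absz (x : int) : x ^+ 2 = (`|x| ^ 2)%N%:Z.
Proof. by rewrite -[RHS]natz natrX natz abszE real_normK ?num_real. Qed.

Lemma sqrn_lt_odd_box a i n : (i < n)%N -> (a ^ 2 <= 8 * i + 3)%N -> (a < 2 * n)%N.
Proof. by move=> i_lt sq; rewrite ltnNge; apply/negP => le_na; nia. Qed.

(** A solution of x^2 + y^2 = 8i+2 consists of odd integers whose triangular numbers add up to [i];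
    the 4 accounts for signs, and [i < n] makes the truncation of psi harmless. *)
Lemma coef_psi_sqr n i : (i < n)%N ->
  4 * (psi R n ^+ 2)`_i = (size (sol2 (8 * i + 2)))%:R.
Proof.
move=> i_lt; rewrite -coefCM (_ : 4%:P = 2 ^+ 2); last by rewrite polyCMn; ring.
rewrite -exprMn psi_odd_box expr2 big_distrlr /=.
under eq_bigr do under eq_bigr do rewrite -exprD.
rewrite -(big_allpairs (F := fun u => 'X^(tri_index u.1 + tri_index u.2))).
rewrite coef_sumXn -size_filter; congr (_%:R); apply: perm_size.
apply: uniq_perm; rewrite ?sol2_uniq //.
  by apply/filter_uniq/allpairs_pair_uniq; apply: odd_box_uniq.
move=> [x y]; rewrite mem_filter mem_allpairs_pair !mem_odd_box mem_sol2 /sq2 /=.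
rewrite !sqrz_absz -!PoszD eqz_nat.
rewrite /tri_index; move: (`|x|%N) (`|y|%N) => a b.
have := sqrn_mod8 a; have := sqrn_mod8 b.
move: (a ^ 2 %/ 8)%N (b ^ 2 %/ 8)%N => a' b' def_b def_a.
apply/andP/idP => [[/eqP def_i /andP[/andP[a_odd _] /andP[b_odd _]]]|].
  by rewrite def_a def_b a_odd b_odd; lia.
rewrite {1}def_a {1}def_b; case: (odd a) def_a; case: (odd b) def_b => def_b def_a;
  try by do ?case: ifP => _; lia.
move=> /eqP sq; split; first by lia.
by rewrite !(@sqrn_lt_odd_box _ i n i_lt) // ?def_a ?def_b; lia.
Qed.

Lemma coef_psi_cube n i : (i < n)%N ->
  8 * (psi R n ^+ 3)`_i = (size (sol3 (8 * i + 3)))%:R.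
Proof.
move=> i_lt; rewrite -coefCM (_ : 8%:P = 2 ^+ 3); last by rewrite polyCMn; ring.
rewrite -exprMn psi_odd_box exprSr expr2 big_distrlr /=.
under eq_bigr do under eq_bigr do rewrite -exprD.
rewrite -(big_allpairs (F := fun u => 'X^(tri_index u.1 + tri_index u.2))).
rewrite big_distrlr /=.
under eq_bigr do under eq_bigr do rewrite -exprD.
rewrite -(big_allpairs (F := fun u =>
  'X^(tri_index u.1.1 + tri_index u.1.2 + tri_index u.2))).
rewrite coef_sumXn -size_filter; congr (_%:R); apply: perm_size.
apply: uniq_perm; rewrite ?sol3_uniq //.
  by apply/filter_uniq; do ?[apply/allpairs_pair_uniq | apply: odd_box_uniq].
move=> [[x y] z]; rewrite mem_filter !mem_allpairs_pair !mem_odd_box mem_sol3 /sq3 /sq2 /=.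
rewrite !sqrz_absz -!PoszD eqz_nat.
rewrite /tri_index; move: (`|x|%N) (`|y|%N) (`|z|%N) => a b c.
have := sqrn_mod8 a; have := sqrn_mod8 b; have := sqrn_mod8 c.
move: (a ^ 2 %/ 8)%N (b ^ 2 %/ 8)%N (c ^ 2 %/ 8)%N => a' b' c' def_c def_b def_a.
apply/andP/idP =>
  [[/eqP def_i /andP[/andP[/andP[a_odd _] /andP[b_odd _]] /andP[c_odd _]]]|].
  by rewrite def_a def_b def_c a_odd b_odd c_odd; lia.
rewrite {1}def_a {1}def_b {1}def_c.
case: (odd a) def_a; case: (odd b) def_b; case: (odd c) def_c => def_c def_b def_a;
  try by do ?case: ifP => _; lia.
move=> /eqP sq; split; first by lia.
by rewrite !(@sqrn_lt_odd_box _ i n i_lt) // ?def_a ?def_b ?def_c; lia.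
Qed.
End TriangularNumbers.

(** * Dissection modulo 5 *)

Section Section5.
Local Open Scope ring_scope.
Variable R : comNzRingType.
Implicit Types p q g : {poly R}.

(** The cut-off at [size p] loses nothing, since i <= 5i + r. *)
Definition sec5 r p : {poly R} := \poly_(i < size p) p`_(5 * i + r)%N.

Lemma coef_sec5 r p i : (sec5 r p)`_i = p`_(5 * i + r)%N.
Proof.
rewrite coef_poly; case: ltnP => // le_i.
by rewrite nth_default // (leq_trans le_i) //; lia.
Qed.

Lemma sec5_eqX r K p q : (r < 5)%N ->
  eqX (5 * K) p q -> eqX K (sec5 r p) (sec5 r q).
Proof. by move=> r_lt pq i i_lt; rewrite !coef_sec5 pq //; lia. Qed.

Lemma sec5D r p q : sec5 r (p + q) = sec5 r p + sec5 r q.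
Proof. by apply/polyP => i; rewrite coefD !coef_sec5 coefD. Qed.

(** A polynomial in X^5 shifts exponents by multiples of 5 only, so it can be taken out of the
    section. *)
Lemma sec5_mul r p g : (r < 5)%N -> sec5 r (p * (g \Po 'X^5)) = sec5 r p * g.
Proof.
move=> r_lt; elim/poly_ind: g p => [|g c IHg] p.
  by rewrite comp_poly0 !mulr0; apply/polyP => i; rewrite coef_sec5 !coef0.
rewrite comp_polyD comp_polyC comp_polyM comp_polyX !mulrDr sec5D; congr (_ + _).
  rewrite mulrA [p * (_ * _)]mulrA -IHg; move: (p * _) => q.
  apply/polyP => i; rewrite coefMX !coef_sec5 coefMXn; case: i => [|i] /=.
    by rewrite muln0 add0n r_lt.
  rewrite ifN; first by congr (_`_ _); lia.
  by rewrite -leqNgt; lia.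
by apply/polyP => i; rewrite coefMC !coef_sec5 coefMC.
Qed.

Lemma sec5_Xn r s g : (r < 5)%N -> (s < 5)%N ->
  sec5 r ('X^s * (g \Po 'X^5)) = (r == s)%:R * g.
Proof.
move=> r_lt s_lt; rewrite sec5_mul //; congr (_ * _); apply/polyP => i.
rewrite coef_sec5 coefXn -polyC_natr coefC; case: i => [|i].
  by rewrite muln0 add0n eqxx; case: eqP.
by rewrite /= (_ : (_ == s) = false) //; lia.
Qed.

(* ['C(n, 2)] for n = 5t+1, .., 5t+5 is 0, 1, 3, 1, 0 modulo 5, and the terms
   with residue 3 form a copy of the whole series. *)
Lemma psi_5dissection n : exists a b : {poly R},
  psi R (5 * n) = (a \Po 'X^5) + 'X * (b \Po 'X^5) +
                  'X^3 * ((psi R n \Po 'X^5) \Po 'X^5).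
Proof.
(* The exponents are C(5t+1, 2) / 5 and C(5t+5, 2) / 5 here, and (C(5t+2, 2) - 1) / 5 and (C(5t+4,
   2) - 1) / 5 in the second witness. *)
exists (\sum_(0 <= t < n) ('X^((5 * t ^ 2 + t)./2) + 'X^((5 * t ^ 2 + 9 * t)./2.+2))).
exists (\sum_(0 <= t < n) ('X^((5 * t ^ 2 + 3 * t)./2) + 'X^((5 * t ^ 2 + 7 * t)./2.+1))).
rewrite /psi mulnC big_nat_mul !raddf_sum /= !mulr_sumr -!big_split /=.
apply: eq_bigr => t _.
rewrite !comp_polyD !comp_Xn_poly -!exprM !comp_Xn_poly -!exprM.
rewrite (_ : (t.+1 * 5 = (t * 5).+4.+1)%N); last by lia.
do 5![rewrite big_nat_recr; last by lia].
rewrite big_geq //= add0r.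
have tri2 k : ('C(k.+1, 2).*2 = k * k.+1)%N.
  by rewrite bin2 /= even_halfK 1?mulnC // oddM /=; case: (odd k).
have half k : odd k -> ((5 * t ^ 2 + k * t)./2.*2 = 5 * t ^ 2 + k * t)%N.
  by move=> k_odd; rewrite even_halfK // oddD !oddM k_odd /=; case: (odd t).
have h1 := half 1%N isT; have h2 := half 9%N isT.
have h3 := half 3%N isT; have h4 := half 7%N isT.
rewrite mul1n in h1.
have e0 : 'C((t * 5).+1, 2) = (5 * (5 * t ^ 2 + t)./2)%N by have := tri2 (t * 5)%N; nia.
have e4 : 'C((t * 5).+4.+1, 2) = (5 * (5 * t ^ 2 + 9 * t)./2.+2)%N.
  by have := tri2 (t * 5).+4; nia.
have e1 : 'C((t * 5).+2, 2) = (1 + 5 * (5 * t ^ 2 + 3 * t)./2)%N.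
  by have := tri2 (t * 5).+1; nia.
have e3 : 'C((t * 5).+4, 2) = (1 + 5 * (5 * t ^ 2 + 7 * t)./2.+1)%N.
  by have := tri2 (t * 5).+3; nia.
have e2 : 'C((t * 5).+3, 2) = (3 + 5 * (5 * 'C(t.+1, 2)))%N.
  by have := tri2 (t * 5).+2; have := tri2 t; nia.
rewrite e0 e1 e2 e3 e4 !exprD !exprM expr1; ring.
Qed.

End Section5.

(** * From pod(5n+2) to sums of three squares modulo 5 *)

Section PodModulo5.
Local Open Scope ring_scope.
Let F : comNzRingType := 'F_5.

Lemma F5_5 : 5 = 0 :> {poly F}.
Proof. by rewrite -polyC_natr (_ : 5%:R = 0) //; apply/eqP. Qed.

Lemma poly_exp5 (p : {poly F}) : p ^+ 5 = p \Po 'X^5.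
Proof.
have charF : 5%N \in [pchar {poly F}] by rewrite !inE /= F5_5 eqxx.
have xF (c : F) : c ^+ 5 = c by apply/eqP; case: c => [[|[|[|[|[|//]]]]]].
elim/poly_ind: p => [|p c IHp]; first by rewrite comp_poly0 expr0n.
rewrite -(pFrobenius_autE charF) rmorphD rmorphM /= !pFrobenius_autE IHp.
by rewrite comp_polyD comp_polyC comp_polyM comp_polyX -polyC_exp xF.
Qed.

(** Two residues among 0, 1, 3 add up to 1 modulo 5 only as 0 + 1 and 3 + 3. *)
Lemma sec5_psi_sqr n (a b : {poly F}) (c := psi F n \Po 'X^5) :
  psi F (5 * n) = (a \Po 'X^5) + 'X * (b \Po 'X^5) + 'X^3 * (c \Po 'X^5) ->
  sec5 1 (psi F (5 * n) ^+ 2) = 2 * (a * b) + 'X * c ^+ 2.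
Proof.
move=> ->.
have -> : ((a \Po 'X^5) + 'X * (b \Po 'X^5) + 'X^3 * (c \Po 'X^5)) ^+ 2 =
  'X^1 * ((2 * (a * b) + 'X * c ^+ 2) \Po 'X^5) + ('X^0 * ((a ^+ 2) \Po 'X^5) +
  ('X^2 * ((b ^+ 2) \Po 'X^5) + ('X^3 * ((2 * a * c) \Po 'X^5) +
   'X^4 * ((2 * b * c) \Po 'X^5)))).
  have Xc := @comp_polyX F 'X^5; ring: Xc.
by rewrite !sec5D !sec5_Xn // !mul0r !addr0 mul1r.
Qed.

(** The section is 6 a^2 b^2 + 12 X a b c^2 + X^2 c^4, which modulo 5 is a perfect square. *)
Lemma sec5_psi_4 n (a b : {poly F}) (c := psi F n \Po 'X^5) :
  psi F (5 * n) = (a \Po 'X^5) + 'X * (b \Po 'X^5) + 'X^3 * (c \Po 'X^5) ->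
  sec5 2 (psi F (5 * n) ^+ 4) = (a * b + 'X * c ^+ 2) ^+ 2.
Proof.
move=> ->.
have -> : ((a \Po 'X^5) + 'X * (b \Po 'X^5) + 'X^3 * (c \Po 'X^5)) ^+ 4 =
  'X^2 * ((6 * a ^+ 2 * b ^+ 2 + 12 * 'X * a * b * c ^+ 2 + 'X ^+ 2 * c ^+ 4) \Po 'X^5) +
  ('X^0 * ((a ^+ 4 + 12 * 'X * a * b ^+ 2 * c + 4 * 'X ^+ 2 * b * c ^+ 3) \Po 'X^5) +
  ('X^1 * ((4 * a ^+ 3 * b + 6 * 'X * a ^+ 2 * c ^+ 2 + 4 * 'X * b ^+ 3 * c) \Po 'X^5) +
  ('X^3 * ((4 * a ^+ 3 * c + 4 * a * b ^+ 3 + 6 * 'X * b ^+ 2 * c ^+ 2) \Po 'X^5) +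
   'X^4 * ((12 * a ^+ 2 * b * c + 4 * 'X * a * c ^+ 3 + b ^+ 4) \Po 'X^5)))).
  have Xc := @comp_polyX F 'X^5; ring: Xc.
rewrite !sec5D !sec5_Xn // !mul0r !addr0 mul1r.
apply/eqP; rewrite -subr_eq0; apply/eqP.
have <- : 5 * (a ^+ 2 * b ^+ 2 + 2 * 'X * a * b * c ^+ 2) = 0 by rewrite F5_5 mul0r.
ring.
Qed.

(** Put z = X c^2. By [sec5_psi_sqr], [size_sol2_5] at 8i+2 reads 4(2ab + z) + 4z = 8 psi^2 in
    degree [i]. Hence ab + z agrees with psi^2 below degree [n], and its square is the section by
    [sec5_psi_4]. *)
Lemma sec5_psi_4_eqX n : eqX n (sec5 2 (psi F (5 * n) ^+ 4)) (psi F (5 * n) ^+ 4).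
Proof.
have [a [b def_psi]] := psi_5dissection F n.
have -> : psi F (5 * n) ^+ 4 = (psi F (5 * n) ^+ 2) ^+ 2 by rewrite -exprM.
rewrite -{1}exprM (sec5_psi_4 def_psi); apply: eqX_exp => i i_lt.
set c := psi F n \Po 'X^5 in def_psi *.
(* The coefficient vanishes unless i = 5l+1; it is then that of psi^2 in degree l, and (8i+2) / 5 =
   8l+2. *)
have zE : 4 * ('X * c ^+ 2)`_i =
    (if (5 %| 8 * i + 2)%N then size (sol2 ((8 * i + 2) %/ 5)) else 0)%:R.
  rewrite coefXM -rmorphXn coef_comp_poly_Xn //.
  case: i i_lt => [|i] i_lt; first by rewrite mulr0.
  rewrite /= (_ : (5 %| 8 * i.+1 + 2)%N = (5 %| i)%N); last by lia.
  case: ifP => [i5|_]; last by rewrite mulr0.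
  rewrite coef_psi_sqr; last by lia.
  by congr (size (sol2 _))%:R; lia.
have /(congr1 (fun p : {poly F} => p`_i)) := sec5_psi_sqr def_psi.
rewrite -/c coef_sec5 !coefD (_ : 2 * (a * b) = (a * b) *+ 2); last by ring.
rewrite coefMn; move: zE; move: (_`_i) (_`_i) => ab z zE psiE.
have := congr1 (fun k : nat => k%:R : F) (size_sol2_5 (8 * i + 2)).
rewrite natrD natrM -zE -(@coef_psi_sqr _ (5 * n)); last by lia.
have -> : (5 * (8 * i + 2) = 8 * (5 * i + 1) + 2)%N by lia.
rewrite -(@coef_psi_sqr _ (5 * n)) ?psiE => [E|]; last by lia.
have F8 : (8 : 'F_5) != 0 by [].
apply: (mulfI F8).
have -> : 8 * (ab + z) = 4 * (ab *+ 2 + z) + 4 * z by ring.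
by rewrite [LHS]E; ring.
Qed.
Lemma dvd5_pod n : (5 %| pod (5 * n + 2))%N = (5 %| size (sol3 (8 * n + 3)))%N.
Proof.
(* An even [k] makes [5 * k] of the form [2 * (5 * n.+1)] required by [pod_poly_psi]. *)
pose k := (2 * n.+1)%N; have n_lt : (n < 5 * k)%N by lia.
have psi0 : (psi F (5 * k))`_0 = 1.
  rewrite /psi /k mulnS big_nat_recl // coefD bin_small // coefXn /=.
  rewrite coef_sum big1 ?addr0 // => i _; rewrite coefXn eq_sym.
  by rewrite (negPf (lt0n_neq0 _)) // bin_gt0.
have P_psi : eqX k (sec5 2 (pod_poly F (2 * (5 * n.+1) + 1))) (psi F (5 * k) ^+ 3).
  (* The claim is multiplied by psi, which enters the section as psi(X^5) = psi^5. One of these five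
     factors cancels the pod series, and the section of psi^4 remains. *)
  apply: (eqX_cancel psi0); rewrite -exprS mulrC -sec5_mul // -poly_exp5.
  apply: eqX_trans _ (@sec5_psi_4_eqX k); apply: sec5_eqX => //.
  rewrite exprS mulrA -[X in eqX _ _ X]mul1r; apply: eqXM => //.
  have -> : (5 * k = 2 * (5 * n.+1))%N by rewrite /k; lia.
  apply: eqX_leq (@pod_poly_psi F (5 * n.+1) _); lia.
have /(congr1 ( *%R 8)) := P_psi n ltac:(rewrite /k; lia).
rewrite coef_psi_cube // coef_sec5 coef_poly ifT; last by lia.
have char5 : 5%N \in [pchar 'F_5] by apply: pchar_Fp.
rewrite mulrCA !(dvdn_pcharf char5) => <-; rewrite mulf_eq0 signr_eq0.
by rewrite mulf_eq0 orFb.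
Qed.

End PodModulo5.

(** * Lipschitz quaternions *)

Section Quaternions.
Local Open Scope ring_scope.

Record quat := Quat { qr : int; qi : int; qj : int; qk : int }.

Definition tuple_of_quat x := (qr x, qi x, qj x, qk x).
Definition quat_of_tuple t := let: (a, b, c, d) := t in Quat a b c d.
Lemma tuple_of_quatK : cancel tuple_of_quat quat_of_tuple.
Proof. by case. Qed.

HB.instance Definition _ := Choice.copy quat (can_type tuple_of_quatK).

Lemma quatP x y :
  qr x = qr y -> qi x = qi y -> qj x = qj y -> qk x = qk y -> x = y.
Proof. by case: x y => [? ? ? ?] [? ? ? ?] /= -> -> -> ->. Qed.

Definition addq x y := Quat (qr x + qr y) (qi x + qi y) (qj x + qj y) (qk x + qk y).
Definition oppq x := Quat (- qr x) (- qi x) (- qj x) (- qk x).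
Definition scaleq m x := Quat (m * qr x) (m * qi x) (m * qj x) (m * qk x).
Definition mulq x y := Quat
  (qr x * qr y - qi x * qi y - qj x * qj y - qk x * qk y)
  (qr x * qi y + qi x * qr y + qj x * qk y - qk x * qj y)
  (qr x * qj y - qi x * qk y + qj x * qr y + qk x * qi y)
  (qr x * qk y + qi x * qj y - qj x * qi y + qk x * qr y).

Fact addqA : associative addq. Proof. by move=> x y z; apply: quatP => /=; ring. Qed.
Fact addqC : commutative addq. Proof. by move=> x y; apply: quatP => /=; ring. Qed.
Fact add0q : left_id (Quat 0 0 0 0) addq.
Proof. by move=> x; apply: quatP => /=; ring. Qed.
Fact addNq : left_inverse (Quat 0 0 0 0) oppq addq.
Proof. by move=> x; apply: quatP => /=; ring. Qed.

HB.instance Definition _ := GRing.isZmodule.Build quat addqA addqC add0q addNq.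

Fact mulqA : associative mulq. Proof. by move=> x y z; apply: quatP => /=; ring. Qed.
Fact mul1q : left_id (Quat 1 0 0 0) mulq.
Proof. by move=> x; apply: quatP => /=; ring. Qed.
Fact mulq1 : right_id (Quat 1 0 0 0) mulq.
Proof. by move=> x; apply: quatP => /=; ring. Qed.
Fact mulqDl : left_distributive mulq addq.
Proof. by move=> x y z; apply: quatP => /=; ring. Qed.
Fact mulqDr : right_distributive mulq addq.
Proof. by move=> x y z; apply: quatP => /=; ring. Qed.
Fact oneq_neq0 : Quat 1 0 0 0 != 0. Proof. by []. Qed.

HB.instance Definition _ :=
  GRing.Zmodule_isNzRing.Build quat mulqA mul1q mulq1 mulqDl mulqDr oneq_neq0.

Fact scaleqA a b x : scaleq a (scaleq b x) = scaleq (a * b) x.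
Proof. by apply: quatP => /=; ring. Qed.
Fact scale1q : left_id 1 scaleq. Proof. by move=> x; apply: quatP => /=; ring. Qed.
Fact scaleqDr : right_distributive scaleq +%R.
Proof. by move=> a x y; apply: quatP => /=; ring. Qed.
Fact scaleqDl x : {morph scaleq^~ x : a b / a + b}.
Proof. by move=> a b; apply: quatP => /=; ring. Qed.

HB.instance Definition _ :=
  GRing.Zmodule_isLmodule.Build int quat scaleqA scale1q scaleqDr scaleqDl.

Fact scaleqAl (a : int) (x y : quat) : a *: (x * y) = a *: x * y.
Proof. by apply: quatP => /=; ring. Qed.
Fact scaleqAr (a : int) (x y : quat) : a *: (x * y) = x * (a *: y).
Proof. by apply: quatP => /=; ring. Qed.

HB.instance Definition _ := GRing.Lmodule_isLalgebra.Build int quat scaleqAl.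
HB.instance Definition _ := GRing.Lalgebra_isAlgebra.Build int quat scaleqAr.

Definition conjq x := Quat (qr x) (- qi x) (- qj x) (- qk x).
Definition normq x := qr x ^+ 2 + qi x ^+ 2 + qj x ^+ 2 + qk x ^+ 2.

Lemma conjqK : involutive conjq.
Proof. by move=> x; apply: quatP => /=; ring. Qed.

Lemma conjqD x y : conjq (x + y) = conjq x + conjq y.
Proof. by apply: quatP => /=; ring. Qed.

Lemma conjqM x y : conjq (x * y) = conjq y * conjq x.
Proof. by apply: quatP => /=; ring. Qed.

Lemma conjqZ m x : conjq (m *: x) = m *: conjq x.
Proof. by apply: quatP => /=; ring. Qed.

Lemma addq_conj x : x + conjq x = (2 * qr x)%:A.
Proof. by apply: quatP => /=; ring. Qed.

Lemma mulq_conj x : x * conjq x = (normq x)%:A.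
Proof. by apply: quatP; rewrite /normq /=; ring. Qed.

Lemma mul_conjq x : conjq x * x = (normq x)%:A.
Proof. by apply: quatP; rewrite /normq /=; ring. Qed.

Lemma normqM x y : normq (x * y) = normq x * normq y.
Proof. by rewrite /normq /=; ring. Qed.

Lemma normqZ m x : normq (m *: x) = m ^+ 2 * normq x.
Proof. by rewrite /normq /=; ring. Qed.

Lemma normq_conj x : normq (conjq x) = normq x.
Proof. by rewrite /normq /=; ring. Qed.

Lemma normq_ge0 x : 0 <= normq x.
Proof. by rewrite /normq !addr_ge0 ?sqr_ge0. Qed.

Lemma normq_eq0 x : (normq x == 0) = (x == 0).
Proof.
apply/eqP/eqP => [|->]; last by rewrite /normq /=; ring.
by rewrite /normq => nx0; apply: quatP => /=; nia.
Qed.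

Lemma scaleqI (m : int) : m != 0 -> injective (fun x : quat => m *: x).
Proof.
by move=> m0 x y [] /(mulfI m0) ? /(mulfI m0) ? /(mulfI m0) ? /(mulfI m0) ?; apply: quatP.
Qed.

Definition dvdq (m : int) (x : quat) : bool :=
  [&& (m %| qr x)%Z, (m %| qi x)%Z, (m %| qj x)%Z & (m %| qk x)%Z].

Lemma dvdqP m x : reflect (exists y, x = m *: y) (dvdq m x).
Proof.
apply: (iffP and4P) => [[/dvdzP[a ra] /dvdzP[b ib] /dvdzP[c jc] /dvdzP[d kd]]|[y ->]].
  by exists (Quat a b c d); apply: quatP; rewrite /= mulrC.
by split; apply: dvdz_mulr.
Qed.

Lemma dvdqZ m x : dvdq m (m *: x). Proof. by apply/dvdqP; exists x. Qed.

Lemma dvdqD m x y : dvdq m x -> dvdq m y -> dvdq m (x + y).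
Proof.
by move=> /dvdqP[x' ->] /dvdqP[y' ->]; rewrite -scalerDr dvdqZ.
Qed.

Lemma dvdq_mull m x y : dvdq m y -> dvdq m (x * y).
Proof. by move=> /dvdqP[y' ->]; rewrite -scalerAr dvdqZ. Qed.

Lemma dvdq_mulr m x y : dvdq m x -> dvdq m (x * y).
Proof. by move=> /dvdqP[x' ->]; rewrite -scalerAl dvdqZ. Qed.

Lemma dvdq_scale m c x : (m %| c)%Z -> dvdq m (c *: x).
Proof. by move=> /dvdzP[d ->]; rewrite mulrC -scalerA dvdqZ. Qed.

Lemma dvdq_conj m x : dvdq m (conjq x) = dvdq m x.
Proof.
apply/idP/idP => [/dvdqP[y /(congr1 conjq)]|/dvdqP[y ->]].
  by rewrite conjqK conjqZ => ->; apply: dvdqZ.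
by rewrite conjqZ dvdqZ.
Qed.

Variable p : nat.
Hypotheses (p_pr : prime p) (p_odd : odd p).

Lemma dvdq_scale_prime c x : ~~ (p %| c)%Z -> dvdq p (c *: x) = dvdq p x.
Proof. by move=> pc; rewrite /dvdq /= !Euclid_dvdzM // (negPf pc). Qed.

Lemma dvdz_prime2 : ~~ (p %| 2)%Z.
Proof.
rewrite dvdzE /= dvdn_prime2 //; apply: contraL p_odd => /eqP->; by [].
Qed.

Lemma dvdz_prime_double c : (p %| 2 * c)%Z = (p %| c)%Z.
Proof. by rewrite Euclid_dvdzM // (negPf dvdz_prime2). Qed.

(* Modulo [p] the quaternions are 2x2 matrices, and [a], [b] have the same
   kernel if both annihilate [z]. *)
Lemma dvdq_mul_conj z a b : ~~ dvdq p z ->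
  dvdq p (a * z) -> dvdq p (b * z) -> dvdq p (b * conjq a).
Proof.
move=> z_ndvd az bz.
have [e] : exists e, ~~ (p %| qr (z * e))%Z.
  move: z_ndvd; rewrite /dvdq !negb_and => /or4P[] zc.
  - by exists 1; rewrite mulr1.
  - exists (Quat 0 (-1) 0 0); apply: contra zc => /=; congr (_ %| _)%Z; ring.
  - exists (Quat 0 0 (-1) 0); apply: contra zc => /=; congr (_ %| _)%Z; ring.
  - exists (Quat 0 0 0 (-1)); apply: contra zc => /=; congr (_ %| _)%Z; ring.
rewrite -dvdz_prime_double => /dvdq_scale_prime <-.
have -> : (2 * qr (z * e)) *: (b * conjq a) =
    b * z * (e * conjq a) + b * conjq e * conjq (a * z).
  rewrite conjqM -!mulrA -mulrDr (mulrA z) (mulrA (conjq e)) -mulrDl -conjqM.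
  by rewrite addq_conj mulr_algl scalerAr.
by apply: dvdqD; [apply: dvdq_mulr | apply: dvdq_mull; rewrite dvdq_conj].
Qed.

Lemma dvdz_normq v b : ~~ dvdq p v -> dvdq p (b * v) -> (p %| normq b)%Z.
Proof.
move=> v_ndvd bv; have := dvdq_mul_conj v_ndvd bv bv.
by rewrite mulq_conj => /and4P[/=]; rewrite mulr1.
Qed.

Lemma sqr4_lt (t m : int) : - m < 2 * t -> 2 * t < m -> 4 * t ^+ 2 < m ^+ 2.
Proof.
move=> lt1 lt2; have : 0 < (2 * t - (- m)) * (m - 2 * t) by rewrite mulr_gt0 ?subr_gt0.
by rewrite -[_ < m ^+ 2]subr_gt0 (_ : (_ * _) = m ^+ 2 - 4 * t ^+ 2) //; ring.
Qed.

(** Each coordinate has a remainder of absolute value below m/2, strictly because [m] is odd, so the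
    four squares add up to less than m^2. *)
Lemma normq_rem (m : nat) b : odd m ->
  exists d, normq (b + m%:Z *: d) < m%:Z ^+ 2.
Proof.
move=> m_odd; have rem (c : int) : exists d : int, 4 * (c + m%:Z * d) ^+ 2 < m%:Z ^+ 2.
  have c_eq := divz_eq c m; have m0 : m%:Z != 0 by lia.
  have := modz_ge0 c m0; have := ltz_pmod c (_ : 0 < m%:Z).
  move: (c %/ m)%Z (c %% m)%Z c_eq => q s -> lt_sm s_ge0.
  have [le_s|lt_s] := leP (2 * s) m.
    exists (- q); rewrite (_ : _ + _ = s); last by ring.
    by apply: sqr4_lt; lia.
  exists (- q - 1); rewrite (_ : _ + _ = s - m%:Z); last by ring.
  by apply: sqr4_lt; lia.
have [[d0 g0] [d1 g1] [d2 g2] [d3 g3]] :=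
  And4 (rem (qr b)) (rem (qi b)) (rem (qj b)) (rem (qk b)).
by exists (Quat d0 d1 d2 d3); rewrite /normq /=; lra.
Qed.

(* Lagrange's descent, carried out by left multiplications so that it stays
   inside the left ideal annihilating [v] modulo [p]. *)
Lemma normq_descent (v b : quat) (m : nat) : ~~ dvdq p v -> (0 < m < p)%N ->
  dvdq p (b * v) -> normq b = (m * p)%N ->
  exists2 a, normq a = p & dvdq p (a * v).
Proof.
move=> v_ndvd; elim/ltn_ind: m b => m IHm b /andP[m_gt0 m_lt] bv nb.
have [m_le1|m_gt1] := leqP m 1.
  by exists b => //; rewrite nb (_ : m = 1%N) ?mul1n //; lia.
have [m_odd|m_even] := boolP (odd m).
  (* Since [g] is [b] modulo [m], its norm is m m' with m' < m, and conj(g) b = m b' where [b'] has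
     norm m' p: the descent continues with [m']. *)
  have [d lt_g] := normq_rem b m_odd; pose g := b + m%:Z *: d.
  pose b' := p%:Z%:A + conjq d * b.
  pose m' := p%:Z + 2 * (qr b * qr d + qi b * qi d + qj b * qj d + qk b * qk d) +
    m%:Z * normq d.
  have ng : normq g = m%:Z * m'.
    rewrite [RHS]mulrDr mulrDr -PoszM -nb /normq /=; ring.
  have gb : conjq g * b = m%:Z *: b'.
    by rewrite conjqD conjqZ mulrDl mul_conjq nb PoszM -scalerA -scalerAl -scalerDr.
  have nb' : normq b' = m' * p%:Z.
    apply: (@mulfI _ (m%:Z ^+ 2)); first by rewrite expf_neq0 //; lia.
    by rewrite -normqZ -gb normqM normq_conj ng nb PoszM; ring.
  have m'_lt : m' < m%:Z.
    by move: lt_g; rewrite -/g ng expr2 ltr_pM2l // ltz_nat.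
  (* If [m'] were 0, then g = 0 and b = -m d, so m p = m^2 N(d) and [m] would divide [p], against 1
     < m < p. *)
  have m'_gt0 : 0 < m'.
    rewrite lt_def; apply/andP; split; last first.
      by have := normq_ge0 g; rewrite ng pmulr_rge0 // ltz_nat.
    apply: contraTneq m_lt => m'0; move/eqP: ng; rewrite m'0 mulr0 normq_eq0.
    rewrite /g addr_eq0 => /eqP def_b; move: nb.
    rewrite def_b -scaleNr normqZ sqrrN PoszM -mulrA => /mulfI def_p.
    have : (m %| p)%N.
      by rewrite -[(m %| p)%N]/(m%:Z %| p%:Z)%Z -def_p ?dvdz_mulr //; lia.
    by case/primeP: p_pr => _ p_div /p_div; lia.
  have m'E : m' = `|m'|%N by rewrite gez0_abs // ltW.
  have m'_bounds : (0 < `|m'| < m)%N by clear -m'E m'_gt0 m'_lt; lia.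
  have [||||a na av] := IHm `|m'|%N _ b'.
  - by case/andP: m'_bounds.
  - by case/andP: m'_bounds => -> /ltn_trans->.
  - rewrite mulrDl mulr_algl -mulrA.
    by apply: dvdqD; [apply: dvdqZ | apply: dvdq_mull].
  - by rewrite nb' PoszM -m'E.
  by exists a.
(* For even [m] the coordinates of [b] have an even sum, so they split into two pairs of equal
   parity; the matching choice among 1+i, 1+j, 1+k makes [e * b] even, and its half has norm (m/2)
   p. *)
have [e ne] : exists2 e, normq e = 2 & dvdq 2 (e * b).
  have : (2 %| qr b + qi b + qj b + qk b)%Z.
    have : (2 %| normq b)%Z by rewrite nb; lia.
    have sqr2 (x : int) : exists y, x ^+ 2 = x + 2 * y.
      exists (x * (x - 1) %/ 2)%Z; have : (2 %| x * (x - 1))%Z.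
        by rewrite (@Euclid_dvdzM 2) //; lia.
      by rewrite dvdz_eq mulrC => /eqP->; ring.
    rewrite /normq; have [[? ->] [? ->] [? ->] [? ->]] :=
      And4 (sqr2 (qr b)) (sqr2 (qi b)) (sqr2 (qj b)) (sqr2 (qk b)); lia.
  have [ri|ri] := boolP (2 %| qr b - qi b)%Z.
    by exists (Quat 1 1 0 0) => //; rewrite /dvdq /=; lia.
  have [rj|rj] := boolP (2 %| qr b - qj b)%Z.
    by exists (Quat 1 0 1 0) => //; rewrite /dvdq /=; lia.
  by exists (Quat 1 0 0 1) => //; rewrite /dvdq /=; lia.
case/dvdqP=> b' def_b'.
have nb' : normq b' = (m./2 * p)%N.
  have := congr1 normq def_b'; rewrite normqM normqZ ne nb => nbb'.
  have : (m = 2 * m./2)%N by lia.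
  by move=> def_m; rewrite def_m in nbb'; lia.
have [||||a na av] := IHm m./2 _ b'; [by lia | by lia | | by [] |].
  have : dvdq p (2 *: (b' * v)) by rewrite scalerAl -def_b' -mulrA dvdq_mull.
  by rewrite dvdq_scale_prime // dvdz_prime2.
by exists a.
Qed.

(** A remainder [g] of conj(v) modulo [p] annihilates [v] because [p] divides N(v). Its norm is k p
    with 0 < k < p, where the descent starts. *)
Lemma exists_normq_prime v : ~~ dvdq p v -> (p %| normq v)%Z ->
  exists2 a, normq a = p & dvdq p (a * v).
Proof.
move=> v_ndvd nv; have p_gt0 := prime_gt0 p_pr.
have [d] := normq_rem (conjq v) p_odd; set g := conjq v + _ => lt_g.
have gv : dvdq p (g * v).
  rewrite mulrDl mul_conjq -scalerAl.
  by apply: dvdqD; [apply: dvdq_scale | apply: dvdqZ].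
have /dvdzP[k nk] := dvdz_normq v_ndvd gv.
have g_neq0 : g != 0.
  apply: contra v_ndvd; rewrite addr_eq0 => /eqP def_v.
  by rewrite -dvdq_conj def_v -scalerN dvdqZ.
have g_gt0 : 0 < normq g by rewrite lt_def normq_eq0 g_neq0 normq_ge0.
have k_gt0 : 0 < k by move: g_gt0; rewrite nk pmulr_lgt0 // ltz_nat.
have k_lt : k < p by move: lt_g; rewrite nk expr2 ltr_pM2r // ltz_nat.
have kE : k = `|k|%N by rewrite gez0_abs // ltW.
apply: (normq_descent v_ndvd (m := `|k|%N)) gv _; last by rewrite PoszM -kE.
by rewrite -!ltz_nat -kE k_gt0.
Qed.

Definition divq x := Quat (qr x %/ p)%Z (qi x %/ p)%Z (qj x %/ p)%Z (qk x %/ p)%Z.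
(** A generator of the isotropic line attached to [x]: in norm p^2 n, with [p] dividing [n] exactly
    once, one division is enough. *)
Definition primq x := if dvdq p x then divq x else x.

Lemma divqK x : dvdq p x -> p%:Z *: divq x = x.
Proof. by case/and4P => *; apply: quatP; rewrite /= mulrC divzK. Qed.

Lemma primq_pure x : qr x = 0 -> qr (primq x) = 0.
Proof. by rewrite /primq; case: ifP => // _ /= ->; rewrite div0z. Qed.

Lemma conjq_pure x : qr x = 0 -> conjq x = - x.
Proof. by move=> x0; apply: quatP; rewrite /= ?x0. Qed.

Lemma mulq_pure x : qr x = 0 -> x * x = (- normq x)%:A.
Proof. by move=> /conjq_pure xc; rewrite scaleNr -mulq_conj xc mulrN opprK. Qed.

Let p_neq0 : p%:Z != 0.
Proof. by rewrite eqz_nat -lt0n prime_gt0. Qed.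

Lemma dvdqN x : dvdq p (- x) = dvdq p x.
Proof. by rewrite /dvdq /= !rpredN. Qed.

Variable n : nat.
Hypotheses (p_dvd_n : (p %| n)%N) (p2_ndvd_n : ~~ (p ^ 2 %| n)%N).

Lemma primq_spec x : qr x = 0 -> normq x = p%:Z ^+ 2 * n%:Z ->
  ~~ dvdq p (primq x) /\ (p %| normq (primq x))%Z.
Proof.
move=> x0 nx; rewrite /primq; case: ifPn => [/divqK x_eq|x_ndvd]; last first.
  by split=> //; rewrite nx expr2 -mulrA dvdz_mulr.
have n_eq : normq (divq x) = n.
  apply: (@mulfI _ (p%:Z ^+ 2)); first by rewrite expf_neq0.
  by rewrite -normqZ x_eq nx.
split; last by rewrite n_eq.
apply: contra p2_ndvd_n => /dvdqP[y y_eq]; move: n_eq; rewrite y_eq normqZ => n_eq.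
rewrite -[(_ %| _)%N]/((p ^ 2)%N%:Z %| n%:Z)%Z -n_eq -[(p ^ 2)%N%:Z]natz natrX natz.
exact: dvdz_mulr.
Qed.

Lemma dvdq_primq_twist q y : normq q = p -> qr y = 0 -> normq y = n ->
  dvdq p (q * primq (conjq q * y * q)).
Proof.
move=> nq y0 ny; set x := conjq q * y * q.
have qx : q * x = p%:Z *: (y * q) by rewrite /x !mulrA mulq_conj nq mulr_algl scalerAl.
have x0 : qr x = 0 by rewrite /x /= y0; ring.
rewrite /primq; case: ifPn => [x_dvd|_]; last by rewrite qx dvdqZ.
set z := divq x; have x_eq : p%:Z *: z = x by apply: divqK.
have z0 : qr z = 0 by rewrite -[qr z]/(qr x %/ p)%Z x0 div0z.
have qz : q * z = y * q by apply: (scaleqI p_neq0); rewrite scalerAr x_eq qx.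
have nz : normq z = n.
  apply: (@mulfI _ (p%:Z ^+ 2)); first by rewrite expf_neq0.
  by rewrite -normqZ x_eq /x !normqM normq_conj nq ny; ring.
rewrite -dvdq_conj conjqM (conjq_pure z0) mulNr dvdqN.
(* Modulo [p], both [q] and [z] annihilate z conj(q), since q z = y q and z^2 = -n. Were it nonzero
   modulo [p], [dvdq_mul_conj] would make it zero. *)
apply: contraT => zq_ndvd; case/negP: (zq_ndvd).
apply: (dvdq_mul_conj zq_ndvd).
  by rewrite mulrA qz -mulrA mulq_conj nq -scalerAr mulr1 dvdqZ.
by rewrite mulrA mulq_pure // mulr_algl dvdq_scale // rpredN nz dvdzE.
Qed.

Lemma twist_surj q x : normq q = p -> qr x = 0 -> normq x = p%:Z ^+ 2 * n%:Z ->
  dvdq p (q * primq x) -> exists y, x = conjq q * y * q.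
Proof.
move=> nq x0 nx; rewrite /primq; case: ifPn => [/divqK x_eq|x_ndvd] /dvdqP[d d_eq].
  exists (d * conjq q).
  rewrite -!mulrA mul_conjq nq mulr_algr -scalerAr scalerAr -d_eq mulrA.
  by rewrite mul_conjq nq mulr_algl.
(* From q x = p d follows x = conj(q) d, so [x] is a twist once [p] divides d conj(q). This holds
   because [q] and [d] both annihilate [x]. *)
have dx : dvdq p (d * x).
  apply/dvdqP; exists (- n%:Z *: q); apply: (scaleqI p_neq0).
  rewrite scalerAl -d_eq -mulrA mulq_pure // nx mulr_algr !scalerA.
  by congr (_ *: _); ring.
have qx : dvdq p (q * x) by rewrite d_eq dvdqZ.
have /dvdqP[y y_eq] := dvdq_mul_conj x_ndvd qx dx.
exists y; have xd : x = conjq q * d.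
  by apply: (scaleqI p_neq0); rewrite scalerAr -d_eq mulrA mul_conjq nq mulr_algl.
apply: (scaleqI p_neq0); rewrite [RHS]scalerAl scalerAr -y_eq -!mulrA mul_conjq nq.
by rewrite mulrA -xd mulr_algr.
Qed.

End Quaternions.

(** * Vectors of norm [p^2 n] in Z^3 *)

Section IsotropicVectors.
Local Open Scope ring_scope.
Variable p : nat.
Hypotheses (p_pr : prime p) (p_odd : odd p).

Lemma intr_Fp_eq0 (x : int) : (x%:~R == 0 :> 'F_p) = (p %| x)%Z.
Proof.
have charFp := pchar_Fp p_pr; rewrite dvdzE /= (dvdn_pcharf charFp).
by case: x => n //; rewrite NegzE mulrNz oppr_eq0.
Qed.

Lemma natr_Fp_eq0 n : (n%:R == 0 :> 'F_p) = (p %| n)%N.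
Proof. by rewrite (dvdn_pcharf (pchar_Fp p_pr)). Qed.

(** Pigeonhole: the (p+1)/2 squares and the (p+1)/2 values -1 - y^2 cannot be disjoint among [p]
    elements. *)
Lemma sum_two_squares_N1 : exists s t : 'F_p, s ^+ 2 + t ^+ 2 = -1.
Proof.
have [|none] := boolP [exists s : 'F_p, exists t : 'F_p, s ^+ 2 + t ^+ 2 == -1].
  by case/existsP=> s /existsP[t /eqP st]; exists s, t.
have sq_inj : injective (fun x : 'I_(p./2.+1) => (x%:R : 'F_p) ^+ 2).
  move=> x y /eqP; rewrite -subr_eq0 subr_sqr mulf_eq0 -natrD natr_Fp_eq0.
  have := ltn_ord x; have := ltn_ord y => y_lt x_lt /orP[|xy].
    wlog le_yx : x y x_lt y_lt / (y <= x)%N => [IH|].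
      case: (leqP y x) => [|/ltnW le_xy]; first exact: IH.
      by rewrite -oppr_eq0 opprB => /IH->.
    rewrite -natrB // natr_Fp_eq0 => xy; apply/val_inj => /=.
    by have := dvdn_leq _ xy; lia.
  by apply/val_inj => /=; have := dvdn_leq _ xy; lia.
pose f (x : 'I_(p./2.+1) + 'I_(p./2.+1)) : 'F_p :=
  match x with inl x => x%:R ^+ 2 | inr y => - 1 - y%:R ^+ 2 end.
have f_inj : injective f.
  have N1 (x y : 'I_(p./2.+1)) : x%:R ^+ 2 = - 1 - y%:R ^+ 2 :> 'F_p -> False.
    move=> xy; case/negP: none; apply/existsP; exists x%:R; apply/existsP; exists y%:R.
    by rewrite xy subrK.
  move=> [x|x] [y|y] //= => [/sq_inj->|/N1|/esym/N1|/addrI/oppr_inj/sq_inj->] //.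
have := leq_card f f_inj; rewrite card_sum card_ord card_Fp //; lia.
Qed.

Definition dot3 (v w : 'F_p * 'F_p * 'F_p) : 'F_p :=
  v.1.1 * w.1.1 + v.1.2 * w.1.2 + v.2 * w.2.

Definition isotropic : {set 'F_p * 'F_p * 'F_p} :=
  [set v : ('F_p * 'F_p * 'F_p)%type | (v != (0, 0, 0)) && (dot3 v v == 0)].

Lemma card_isotropic : #|isotropic| = (p ^ 2).-1.
Proof.
have [s [t st]] := sum_two_squares_N1.
have two_neq0 : 2 != 0 :> 'F_p.
  by rewrite natr_Fp_eq0 dvdn_prime2 //; apply: contraL p_odd => /eqP->.
(* [L] is the change of variables turning [a^2 + b^2 + c^2] into [e f - w^2]. *)
pose L (y : 'F_p * 'F_p * 'F_p) : 'F_p * 'F_p * 'F_p :=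
  let: (e, f, w) := y in
  (s * ((f - e) / 2) - t * w, t * ((f - e) / 2) + s * w, (e + f) / 2).
pose G (v : 'F_p * 'F_p * 'F_p) : 'F_p * 'F_p * 'F_p :=
  let: (a, b, c) := v in (c + (s * a + t * b), c - (s * a + t * b), t * a - s * b).
have GK : cancel L G.
  move=> [[e f] w] /=; set u := (f - e) / 2; set c := (e + f) / 2.
  have -> : s * (s * u - t * w) + t * (t * u + s * w) = (s ^+ 2 + t ^+ 2) * u by ring.
  have -> : t * (s * u - t * w) - s * (t * u + s * w) = - (s ^+ 2 + t ^+ 2) * w by ring.
  by rewrite st /u /c; congr (_, _, _); field.
have LK : cancel G L.
  move=> [[a b] c] /=.
  have -> : (c - (s * a + t * b) - (c + (s * a + t * b))) / 2 = - (s * a + t * b) by field.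
  have -> : (c + (s * a + t * b) + (c - (s * a + t * b))) / 2 = c by field.
  rewrite (_ : _ - _ = - (s ^+ 2 + t ^+ 2) * a); last by ring.
  rewrite [X in (_, X, _)](_ : _ = - (s ^+ 2 + t ^+ 2) * b); last by ring.
  by rewrite st !(opprK, mul1r).
have dotL e f w : dot3 (L (e, f, w)) (L (e, f, w)) = e * f - w ^+ 2.
  rewrite /dot3 /=; set u := (f - e) / 2; set c := (e + f) / 2.
  transitivity ((s ^+ 2 + t ^+ 2) * (u ^+ 2 + w ^+ 2) + c ^+ 2); first by ring.
  by rewrite st /u /c; field.
(* The p^2 zeros of e f - w^2: a nonzero e and any w determine f, while e = 0 forces w = 0 and
   leaves f free. *)
pose H (x : 'F_p * 'F_p) : 'F_p * 'F_p * 'F_p :=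
  if x.1 == 0 then (0, x.2, 0) else (x.1, x.2 ^+ 2 / x.1, x.2).
have H_inj : injective H.
  move=> [x1 x2] [y1 y2]; rewrite /H /=.
  case: (eqVneq x1 0) => [->|x1n]; case: (eqVneq y1 0) => [->|y1n].
  - by case=> ->.
  - by case=> /esym/eqP; rewrite (negPf y1n).
  - by case=> /eqP; rewrite (negPf x1n).
  - by case=> -> _ ->.
have -> : isotropic = [set L (H x) | x in setT] :\ (0, 0, 0).
  apply/setP => v; rewrite !inE; congr (_ && _); apply/eqP/imsetP => [|[x _ ->]].
    rewrite -(LK v); case: (G v) => [[e f] w]; rewrite dotL => /eqP.
    rewrite subr_eq0 => /eqP ef; exists (if e == 0 then (0, f) else (e, w)) => //.
    rewrite /H; case: (eqVneq e 0) ef => [->|e_neq0] ef /=.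
      by move/esym/eqP: ef; rewrite mul0r sqrf_eq0 ?eqxx => /eqP->.
    by rewrite (negPf e_neq0) -ef mulrAC divff ?mul1r.
  rewrite /H; case: eqVneq => [_|x_neq0]; rewrite dotL ?mul0r ?expr0n ?subr0 //.
  by rewrite mulrC divfK ?subrr.
have L00 : L (H (0, 0)) = (0, 0, 0) by rewrite /H /L /= !(subr0, addr0, mul0r, mulr0).
have im0 : (0, 0, 0) \in [set L (H x) | x in setT] by apply/imsetP; exists (0, 0).
have := cardsD1 (0, 0, 0) [set L (H x) | x in setT].
rewrite im0 card_imset; last exact: inj_comp (can_inj GK) H_inj.
by rewrite cardsT card_prod card_Fp // mulnn => ->.
Qed.

(** The conditions are the vanishing of the dot and cross products with [w], which leaves the
    nonzero multiples of [w]. *)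
Lemma card_isotropic_line w : w \in isotropic ->
  #|[set v in isotropic | [&& dot3 v w == 0, v.1.1 * w.1.2 == v.1.2 * w.1.1,
      v.1.2 * w.2 == v.2 * w.1.2 & v.2 * w.1.1 == v.1.1 * w.2]]| = p.-1.
Proof.
case: w => [[w1 w2] w3]; rewrite inE /dot3 /= => /andP[w_neq0 /eqP ww0].
set A := [set v in _ | _]; pose f (c : 'F_p) := (c * w1, c * w2, c * w3).
have -> : A = [set f c | c in [set~ 0]].
  apply/setP => -[[v1 v2] v3]; apply/idP/imsetP => [|[c c_neq0 [-> -> ->]]].
    rewrite !inE /= => /andP[/andP[v_neq0 _] /and4P[_ /eqP e12 /eqP e23 /eqP e31]].
    have neq0 c : (v1, v2, v3) = f c -> c \in [set~ 0].
      move=> def_v; rewrite !inE; apply: contraNneq v_neq0 => c0.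
      by rewrite def_v /f c0 !mul0r.
    have [w10|w1n] := eqVneq w1 0; last first.
      suff def_v : (v1, v2, v3) = f (v1 / w1) by exists (v1 / w1); rewrite ?(neq0 _ def_v).
      by rewrite /f divfK // mulrAC e12 mulfK // mulrAC -e31 mulfK.
    have [w20|w2n] := eqVneq w2 0; last first.
      suff def_v : (v1, v2, v3) = f (v2 / w2) by exists (v2 / w2); rewrite ?(neq0 _ def_v).
      by rewrite /f divfK // mulrAC -e12 mulfK // mulrAC e23 mulfK.
    have w3n : w3 != 0.
      by apply: contraNneq w_neq0 => w30; rewrite w10 w20 w30.
    suff def_v : (v1, v2, v3) = f (v3 / w3) by exists (v3 / w3); rewrite ?(neq0 _ def_v).
    by rewrite /f divfK // mulrAC e31 mulfK // mulrAC -e23 mulfK.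
  rewrite !inE in c_neq0; rewrite !inE /dot3 /=; apply/andP; split; last first.
    rewrite (_ : _ + _ = c * (w1 * w1 + w2 * w2 + w3 * w3)); last by ring.
    by rewrite ww0 mulr0 eqxx /=; apply/and3P; split; apply/eqP; ring.
  apply/andP; split; last first.
    rewrite (_ : _ + _ = c ^+ 2 * (w1 * w1 + w2 * w2 + w3 * w3)); last by ring.
    by rewrite ww0 mulr0.
  by apply: contra w_neq0; rewrite !xpair_eqE !mulf_eq0 (negPf c_neq0).
rewrite card_imset ?cardsC1 ?card_Fp // => c d /eqP.
rewrite !xpair_eqE => /andP[/andP[/eqP e1 /eqP e2] /eqP e3].
have : (c - d) * w1 == 0 by rewrite mulrBl e1 subrr.
have : (c - d) * w2 == 0 by rewrite mulrBl e2 subrr.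
have : (c - d) * w3 == 0 by rewrite mulrBl e3 subrr.
rewrite !mulf_eq0 subr_eq0; case: (eqVneq c d) => //= _ /eqP w30 /eqP w20 /eqP w10.
by rewrite w10 w20 w30 eqxx in w_neq0.
Qed.

End IsotropicVectors.

(** * Counting vectors of norm p^2 n over the isotropic lines *)

Section ThreeSquares.
Local Open Scope ring_scope.
Variables p n : nat.
Hypotheses (p_pr : prime p) (p_odd : odd p).
Hypotheses (p_dvd_n : (p %| n)%N) (p2_ndvd_n : ~~ (p ^ 2 %| n)%N).

Definition pureq (u : int * int * int) := Quat 0 u.1.1 u.1.2 u.2.
Definition imq x := (qi x, qj x, qk x).
Definition liftq (v : 'F_p * 'F_p * 'F_p) : quat :=
  Quat 0 (v.1.1 : nat) (v.1.2 : nat) (v.2 : nat).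
Definition modq x : 'F_p * 'F_p * 'F_p := ((qi x)%:~R, (qj x)%:~R, (qk x)%:~R).

Lemma pureqK u : imq (pureq u) = u. Proof. by case: u => [[? ?] ?]. Qed.
Lemma imqK x : qr x = 0 -> pureq (imq x) = x.
Proof. by move=> x0; apply: quatP. Qed.
Lemma normq_pureq u : normq (pureq u) = sq3 u.
Proof. by rewrite /normq /sq3 /sq2 /=; ring. Qed.

Lemma liftqK v : modq (liftq v) = v.
Proof. by case: v => [[a b] c]; rewrite /modq /=; congr (_, _, _); apply: natr_Zp. Qed.

Lemma modq_eq0 x : qr x = 0 -> (modq x == (0, 0, 0)) = dvdq p x.
Proof.
by move=> x0; rewrite /dvdq x0 dvdz0 !xpair_eqE !intr_Fp_eq0 // -andbA.
Qed.

Lemma modq_dot3 x : qr x = 0 -> (dot3 (modq x) (modq x) == 0) = (p %| normq x)%Z.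
Proof.
move=> x0; rewrite -intr_Fp_eq0 // /normq x0 /dot3 /=.
by rewrite !rmorphD /= !rmorphXn /= expr0n add0r.
Qed.

Lemma mem_isotropic x : qr x = 0 ->
  (modq x \in isotropic p) = ~~ dvdq p x && (p %| normq x)%Z.
Proof. by move=> x0; rewrite inE modq_eq0 // modq_dot3. Qed.

(** A product of pure quaternions has minus the dot product as real part and the cross product as
    imaginary part. *)
Lemma dvdq_mul_pure x y : qr x = 0 -> qr y = 0 -> dvdq p (x * y) =
  (let v := modq x in let w := modq y in
   [&& dot3 v w == 0, v.1.1 * w.1.2 == v.1.2 * w.1.1,
      v.1.2 * w.2 == v.2 * w.1.2 & v.2 * w.1.1 == v.1.1 * w.2]).
Proof.
move=> x0 y0; set v := modq x; set w := modq y; rewrite /dvdq -!intr_Fp_eq0 //.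
have -> : (qr (x * y))%:~R = - dot3 v w by rewrite /dot3 /= x0 y0; ring.
have -> : (qi (x * y))%:~R = v.1.2 * w.2 - v.2 * w.1.2 by rewrite /= x0 y0; ring.
have -> : (qj (x * y))%:~R = v.2 * w.1.1 - v.1.1 * w.2 by rewrite /= x0 y0; ring.
have -> : (qk (x * y))%:~R = v.1.1 * w.1.2 - v.1.2 * w.1.1 by rewrite /= x0 y0; ring.
by rewrite oppr_eq0 !subr_eq0; congr (_ && _); rewrite andbA andbC.
Qed.

Definition parallel v (x : int * int * int) : bool :=
  dvdq p (liftq v * primq p (pureq x)).

Lemma card_parallel x : x \in sol3 (p ^ 2 * n) ->
  #|[set v in isotropic p | parallel v x]| = p.-1.
Proof.
rewrite mem_sol3 PoszM -[(p ^ 2)%N%:Z]natz natrX natz -normq_pureq => /eqP nx.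
have w0 : qr (primq p (pureq x)) = 0 by apply: primq_pure.
have [w_ndvd nw] := primq_spec p_pr p_dvd_n p2_ndvd_n (erefl : qr (pureq x) = 0) nx.
have w_iso : modq (primq p (pureq x)) \in isotropic p by rewrite mem_isotropic ?w_ndvd.
rewrite -(card_isotropic_line p_pr w_iso); apply: eq_card => v; rewrite !inE.
by rewrite /parallel dvdq_mul_pure // liftqK.
Qed.

(** For a quaternion [q] of norm [p] annihilating [v], the map y -> conj(q) y q is a bijection from
    the vectors of norm [n] onto the vectors of norm p^2 n parallel to [v]. *)
Lemma count_parallel v : v \in isotropic p ->
  count (parallel v) (sol3 (p ^ 2 * n)) = size (sol3 n).
Proof.
rewrite -{1}(liftqK v) mem_isotropic //; set u := liftq v => /andP[u_ndvd nu].
have [q nq qu] := exists_normq_prime p_pr p_odd u_ndvd nu.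
have q_ndvd : ~~ dvdq p (conjq q).
  apply/negP => /dvdqP[r /(congr1 normq)]; rewrite normq_conj nq normqZ => /esym p_eq.
  have : (p ^ 2 %| p)%N.
    rewrite -[(_ %| _)%N]/((p ^ 2)%N%:Z %| p%:Z)%Z -[in X in (_ %| X)%Z]p_eq.
    by rewrite -[(p ^ 2)%N%:Z]natz natrX natz dvdz_mulr.
  by move/(dvdn_leq (prime_gt0 p_pr)); have := prime_gt1 p_pr; nia.
(* Being parallel to [v] is the same as being annihilated by [q]: [dvdq_mul_conj] is applied to [u]
   in one direction and to conj(q) in the other. *)
have relE w : qr w = 0 -> (p %| normq w)%Z -> dvdq p (u * w) = dvdq p (q * w).
  move=> w0 nw; have wc := conjq_pure w0.
  have uc : conjq u = - u by apply: conjq_pure.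
  apply/idP/idP => [uw|qw].
    rewrite -dvdqN -mulrN -wc; apply: (dvdq_mul_conj p_pr p_odd u_ndvd _ qu).
    by rewrite -dvdq_conj conjqM wc uc mulrNN.
  rewrite -dvdqN -mulrN -wc; apply: (dvdq_mul_conj p_pr p_odd q_ndvd).
    by rewrite -dvdq_conj conjqM conjqK wc mulrN dvdqN.
  by rewrite -dvdq_conj conjqM conjqK uc mulrN dvdqN.
have normE x : x \in sol3 (p ^ 2 * n) -> normq (pureq x) = p%:Z ^+ 2 * n%:Z.
  rewrite mem_sol3 => /eqP sq_x.
  by rewrite normq_pureq sq_x PoszM -[(p ^ 2)%N%:Z]natz natrX natz.
have p_neq0 : p%:Z != 0 by rewrite eqz_nat -lt0n prime_gt0.
pose f y := imq (conjq q * pureq y * q).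
have f_pure y : qr (conjq q * pureq y * q) = 0 by rewrite /=; ring.
rewrite -size_filter -(size_map f (sol3 n)); apply: perm_size; apply: uniq_perm.
- exact/filter_uniq/sol3_uniq.
- rewrite map_inj_uniq ?sol3_uniq // => y z /(congr1 pureq).
  rewrite !imqK // => /(congr1 (fun x => q * x * conjq q)).
  rewrite !mulrA mulq_conj nq -!mulrA mulq_conj nq !mulr_algl !mulr_algr.
  by do 2![move/(scaleqI p_neq0)]; move/(congr1 imq); rewrite !pureqK.
move=> x; rewrite mem_filter; apply/andP/mapP => [[]|[y]].
  move=> + xS; have nx := normE x xS; rewrite /parallel relE ?primq_pure //; last first.
    by have [] := primq_spec p_pr p_dvd_n p2_ndvd_n (erefl : qr (pureq x) = 0) nx.
  case/(twist_surj p_pr p_odd nq (erefl : qr (pureq x) = 0) nx) => y x_eq.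
  have y0 : qr y = 0.
    apply: (mulfI p_neq0); rewrite mulr0 -nq -[RHS]/(qr (pureq x)) x_eq.
    by rewrite /normq /=; ring.
  have ny : normq y = n.
    apply: (@mulfI _ (p%:Z ^+ 2)); first by rewrite expf_neq0.
    by rewrite -nx x_eq !normqM normq_conj nq; ring.
  exists (imq y); first by rewrite mem_sol3 -normq_pureq imqK // ny.
  by rewrite /f imqK // -x_eq pureqK.
rewrite mem_sol3 -normq_pureq => /eqP ny x_eq.
have nx : normq (pureq x) = p%:Z ^+ 2 * n%:Z.
  by rewrite x_eq imqK // !normqM normq_conj nq ny; ring.
have xS : x \in sol3 (p ^ 2 * n).
  by rewrite mem_sol3 -normq_pureq nx PoszM -[(p ^ 2)%N%:Z]natz natrX natz.
split=> //; rewrite /parallel relE ?primq_pure //; last first.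
  by have [] := primq_spec p_pr p_dvd_n p2_ndvd_n (erefl : qr (pureq x) = 0) nx.
by rewrite x_eq imqK //; apply: (dvdq_primq_twist p_pr p_odd p_dvd_n).
Qed.

(** Double counting of parallel pairs: each [x] has p - 1 vectors [v], and each of the p^2 - 1
    isotropic [v] has r_3(n) vectors [x]. *)
Lemma size_sol3_p2 : ((p.-1) * size (sol3 (p ^ 2 * n)) = (p ^ 2).-1 * size (sol3 n))%N.
Proof.
rewrite -card_isotropic // -sum_nat_const.
rewrite (eq_bigr (fun v => \sum_(x <- sol3 (p ^ 2 * n) | parallel v x) 1%N)); last first.
  by move=> v v_iso; rewrite sum1_count count_parallel.
rewrite (exchange_big_dep predT) //= mulnC -sum1_size big_distrl /= big_seq.
rewrite [RHS]big_seq; apply: eq_bigr => x xS; rewrite mul1n -(card_parallel xS).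
by rewrite -sum1_card; apply: eq_bigl => v; rewrite inE.
Qed.

End ThreeSquares.

Theorem theorem5 (p N : nat) (p_prime : prime p) (p_mod5 : p = 4 %[mod 5])
    (N_gt0 : 0 < N) (copNp : coprime N p) (pN_mod8 : p * N = 3 %[mod 8]) :
  pod ((5 * p ^ 3 * N + 1) %/ 8) = 0 %[mod 5].
Proof.
have p_odd : odd p by case: (even_prime p_prime) p_mod5 => // ->.
(* Coprimality makes [p] divide [p * N] exactly once, as [size_sol3_p2] requires. *)
have p2_ndvd : ~~ (p ^ 2 %| p * N).
  rewrite expnS expn1 dvdn_pmul2l ?prime_gt0 // -prime_coprime // coprime_sym //.
have /eqP := size_sol3_p2 p_prime p_odd (dvdn_mulr N (dvdnn p)) p2_ndvd.
have -> : (p ^ 2).-1 = p.-1 * p.+1.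
  by rewrite -subn1 -[1 in LHS](exp1n 2) subn_sqr subn1 addn1.
rewrite -mulnA eqn_pmul2l; last by have := prime_gt1 p_prime; lia.
have -> : p ^ 2 * (p * N) = p ^ 3 * N by rewrite mulnA -expnSr.
have p5 : 5 %| p.+1 by lia.
move/eqP => size_eq.
have [m m_eq] : exists m, p ^ 3 * N = 8 * m + 3.
  (* As p^2 is 1 modulo 8, p^3 N has the residue 3 of p N. *)
  exists (p ^ 3 * N %/ 8); rewrite {1}(divn_eq (p ^ 3 * N) 8) mulnC; congr (_ + _).
  rewrite expnSr -mulnA -modnMmr pN_mod8 modnMmr (sqrn_mod8 p) p_odd.
  by rewrite mulnDl mul1n -mulnA mulnC modnMDl.
have -> : (5 * p ^ 3 * N + 1) %/ 8 = 5 * m + 2 by rewrite -mulnA m_eq; lia.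
by apply/eqP; rewrite mod0n -/(_ %| _) dvd5_pod -m_eq size_eq dvdn_mulr.
Qed.
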